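(* Let $k$ and $d$ be relatively prime positive integers with $k>2d$, and let $s$ be the element of $\mathbb{Z}_k$ such that $sd\equiv 1 \pmod k$. Let $e$ be an edge in a graph $G$ such that $G-e$ is $K_{k:d}$-colorable and $G$ is not $K_{k:d}$-colorable. If $e$ does not lie in any cycle of $G$ with length congruent to $is$ modulo $k$ for some $i\in\{1,\ldots,d-1\}$, then $e$ lies in at least two cycles of $G$ with length congruent to $1$ modulo $k$, and $G-e$ contains a cycle with length congruent to $0$ modulo $k$.
   Context: Graphs are finite, simple and undirected. $G-e$ denotes the graph obtained from $G$ by deleting the edge $e$ (keeping all vertices). The circular clique $K_{k:d}$ is the graph with vertex set $\mathbb{Z}_k$ in which $i$ and $j$ are adjacent if and only if $d\le j-i\le k-d$, where $j-i$ is taken modulo $k$ as a representative in $\{0,\ldots,k-1\}$. A homomorphism from a graph $G$ to a graph $H$ is a map $\phi\colon V(G)\to V(H)$ such that $uv\in E(G)$ implies $\phi(u)\phi(v)\in E(H)$. A graph $G$ is $K_{k:d}$-colorable (equivalently, $(k,d)$-colorable) if there is a homomorphism from $G$ to $K_{k:d}$. Cycles are counted as subgraphs (without a chosen starting vertex or direction), and the length of a cycle is its number of edges. When $d=1$ the set $\{1,\ldots,d-1\}$ is empty. *)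

(* Defs.v *)
From mathcomp Require Import all_boot all_order all_algebra.

Set Implicit Arguments.
Unset Strict Implicit.
Unset Printing Implicit Defensive.

(* Simple graphs are symmetric irreflexive relations on a finType, and an edge
   is the unordered pair of its ends. *)
Definition simple_graph (T : finType) (G : rel T) : Prop :=
  symmetric G /\ irreflexive G.

Definition edges (T : finType) (G : rel T) : {set {set T}} :=
  [set [set x; y] | x in T, y in T & G x y].

Definition delete_edge (T : finType) (G : rel T) (e : {set T}) : rel T :=
  fun x y => G x y && ([set x; y] != e).

(* The subtraction is that of the ring 'Z_k, and the comparisons are between
   natural numbers, 'Z_k being identified with {0, ..., k-1}; this requires
   1 < k, as 'Z_0 and 'Z_1 both denote the integers mod 2. *)
Definition circular_clique (k d : nat) : rel 'Z_k :=
  fun i j => d <= (j - i)%R <= k - d.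
Arguments circular_clique : clear implicits.

Definition homomorphism (T U : finType) (G : rel T) (H : rel U)
    (phi : T -> U) : Prop :=
  forall x y, G x y -> H (phi x) (phi y).

Definition circular_colorable (T : finType) (k d : nat) (G : rel T) : Prop :=
  exists phi : T -> 'Z_k, homomorphism G (circular_clique k d) phi.

Definition cyclic_edges (T : finType) (p : seq T) : {set {set T}} :=
  [set [set x; next p x] | x in p].

(* A cycle is a subgraph without isolated vertices, so it is represented by its
   set of edges C, independently of a starting vertex and a direction; its
   length is #|C|.  The bound on size p excludes closed walks of the form
   [:: x; y] along a single edge. *)
Definition is_cycle (T : finType) (G : rel T) (C : {set {set T}}) : Prop :=
  exists p : seq T, [/\ 2 < size p, ucycle G p & C = cyclic_edges p].

(* Main.v *)
Require Import Defs.
From mathcomp Require Import all_boot all_order all_algebra.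
From mathcomp Require Import zify.

Set Implicit Arguments.
Unset Strict Implicit.
Unset Printing Implicit Defensive.

Import GRing.Theory.

(** The proof pushes a coloring around the circle.  Let [phi] be a coloring of
    [H = G - e] and let [e] join [x] and [y].  Call an edge [uv] of [H],
    directed from [u] to [v], tight when [phi v = phi u + d]: these are the only
    edges that forbid raising the color of [u] alone by 1.  Hence raising by 1
    every vertex reachable from [x] along tight arcs gives again a coloring of
    [H] ([homomorphism_shift]).  If [y] is not reachable, this moves the color
    of [x] one step away from that of [y].

    A tight path with [l] edges from [x] to [y] adds [l * d] to the color, so
    if [phi x = phi y + m] then [(l + 1) * d = d - m], and with [e] the path
    closes to a cycle through [e] of length [(d - m) * s] modulo [k].  When
    [0 < m < d] such cycles are excluded; so [y] is not reachable from [x], and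
    repeated shifts raise [m] to [d], where the coloring of [H] also colors [G].
    Thus no coloring of [H] has [phi x = phi y + m] with [0 < m <= d]
    ([no_coloring_ahead]), nor [phi y = phi x + m] by symmetry.  Other nonzero
    differences would make [phi] a coloring of [G], so every coloring of [H]
    gives [x] and [y] the same color ([same_end_color]).

    Fix one coloring.  Since a shift would separate [x] from [y], there are
    tight paths from [x] to [y] and from [y] to [x].  Each closes with [e] to a
    cycle of length [d * s = 1] modulo [k].  These cycles are different, because
    an edge cannot be tight in both directions when [0 < 2 * d < k].  Finally,
    the two paths together contain a directed tight cycle of [H], whose length
    [l] satisfies [l * d = 0], hence [l = 0], modulo [k]. *)

(** * Residues modulo k and the circular clique *)

Lemma Zp_nat_eqmod (k m n : nat) :
  1 < k -> (m%:R = n%:R :> 'Z_k)%R -> m = n %[mod k].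
Proof.
by move=> k_gt1 /(congr1 val) /=; rewrite -[LHS]/(nat_of_ord _)
  -[RHS]/(nat_of_ord _) !val_Zp_nat.
Qed.

Lemma eqmod_mul_inverse (k d s n i : nat) :
  s * d = 1 %[mod k] -> n * d = i %[mod k] -> n = i * s %[mod k].
Proof.
move=> sd nd; rewrite -modnMml -nd modnMml -mulnA (mulnC d).
by rewrite -modnMmr sd modnMmr muln1.
Qed.

Lemma circular_cliqueP (k d : nat) (i j : 'Z_k) : 1 < k -> 0 < d ->
  reflect (exists2 z, d <= z <= k - d & j = (i + z%:R)%R)
    (circular_clique k d i j).
Proof.
move=> k_gt1 d_gt0; apply: (iffP idP) => [ij | [z z_range ->]].
  by exists (j - i)%R; rewrite // natr_Zp addrC subrK.
by rewrite /circular_clique addrAC subrr add0r val_Zp_nat // modn_small //; lia.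
Qed.

Lemma circular_clique_sym (k d : nat) : 1 < k -> 0 < d ->
  symmetric (circular_clique k d).
Proof.
move=> k_gt1 d_gt0.
suff imp i j : circular_clique k d i j -> circular_clique k d j i.
  by move=> i j; apply/idP/idP; apply: imp.
case/(circular_cliqueP _ _ k_gt1 d_gt0) => z z_range ->.
apply/circular_cliqueP => //; exists (k - z); first by lia.
have le_zk : z <= k by lia.
by rewrite natrB // pchar_Zp // add0r addrK.
Qed.

Lemma circular_clique_step (k d : nat) (i j : 'Z_k) : 1 < k -> 0 < d ->
  circular_clique k d i j -> j != (i + d%:R)%R -> circular_clique k d (i + 1)%R j.
Proof.
move=> k_gt1 d_gt0 /(circular_cliqueP _ _ k_gt1 d_gt0)[z z_range ->] neq_zd.
have {neq_zd} neq_zd : z != d by apply: contraNneq neq_zd => ->.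
apply/circular_cliqueP => //; exists z.-1; first by lia.
have {1}-> : z = z.-1.+1 by lia.
by rewrite -[in LHS]natr1 addrAC addrA addrAC.
Qed.

(** * Cycles and their edge sets *)

(** Two vertices that are each other's successor fill the whole cycle, so
    distinct vertices of a cycle of length at least 3 start distinct edges. *)
Lemma card_cyclic_edges (T : finType) (p : seq T) :
  2 < size p -> uniq p -> #|cyclic_edges p| = size p.
Proof.
move=> p_gt2 p_uniq; rewrite card_in_imset; first by apply/card_uniqP.
have next_next u : u \in p -> next p (next p u) != u.
  case/rot_to => i q def_q.
  have: 2 < size (u :: q) by rewrite -def_q size_rot.
  have: uniq (u :: q) by rewrite -def_q rot_uniq.
  rewrite -!(next_rot i p_uniq) def_q.
  case: q {def_q} => [|v [|w q]] //= /and3P[]; rewrite !inE !eqxx.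
  rewrite !negb_or => /and3P[uv uw _] _ _ _.
  by rewrite (eq_sym v) (negPf uv) eq_sym.
move=> u v up vp /= eq_uv; apply/eqP/idPn => neq_uv.
have: v \in [set u; next p u] by rewrite eq_uv set21.
have: u \in [set v; next p v] by rewrite -eq_uv set21.
rewrite !in_set2 (eq_sym v u) (negPf neq_uv) /= => /eqP u_v /eqP v_u.
by move: (next_next u up); rewrite -v_u -u_v eqxx.
Qed.

Lemma next_last (T : finType) (x : T) (p : seq T) :
  uniq (x :: p) -> next (x :: p) (last x p) = x.
Proof. by move/cycle_next; rewrite /= rcons_path => /andP[_ /eqP]. Qed.

Lemma cyclic_edges_at (T : finType) (p : seq T) (u w : T) :
  uniq p -> [set u; w] \in cyclic_edges p -> w = next p u \/ w = prev p u.
Proof.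
move=> p_uniq /imsetP[v _ eq_uw].
have: u \in [set v; next p v] by rewrite -eq_uw set21.
have: w \in [set v; next p v] by rewrite -eq_uw set22.
have: v \in [set u; w] by rewrite eq_uw set21.
have: next p v \in [set u; w] by rewrite eq_uw set22.
rewrite !in_set2 => nv_uw v_uw w_v u_v.
have [def_u | neq_uv] := eqVneq u v.
  left; move: nv_uw w_v; rewrite -def_u.
  by case: (eqVneq w u) => [-> /orP[]/eqP -> | _ _ /eqP].
right; move: v_uw u_v; rewrite (eq_sym v u) (negPf neq_uv) /= => /eqP <- /eqP ->.
by rewrite prev_next.
Qed.

Lemma next_in_cyclic_edges (T : finType) (p : seq T) (u : T) :
  u \in p -> [set u; next p u] \in cyclic_edges p.
Proof. by move=> up; apply/imsetP; exists u. Qed.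

(** * Tight arcs *)

Definition tight (T : finType) (k d : nat) (H : rel T) (phi : T -> 'Z_k) :
  rel T := fun u v => H u v && (phi v == (phi u + d%:R)%R).
Arguments tight : clear implicits.

Lemma tight_path_color (T : finType) (k d : nat) (H : rel T) (phi : T -> 'Z_k)
    (x : T) (p : seq T) :
  path (tight T k d H phi) x p -> phi (last x p) = (phi x + (size p * d)%:R)%R.
Proof.
elim: p x => [|y p IHp] x /=; first by rewrite addr0.
by case/andP=> /andP[_ /eqP def_y] /IHp ->; rewrite def_y mulSn natrD addrA.
Qed.

Lemma sub_tight (T : finType) (k d : nat) (H : rel T) (phi : T -> 'Z_k) :
  subrel (tight T k d H phi) H.
Proof. by move=> u v /andP[]. Qed.

(** Exchanging the ends of a tight arc negates [d], and [2 * d < k]. *)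
Lemma tight_asym (T : finType) (k d : nat) (H : rel T) (phi : T -> 'Z_k)
    (u v : T) :
  0 < d -> 2 * d < k ->
  tight T k d H phi u v -> tight T k d H phi v u -> False.
Proof.
move=> d_gt0 d2k /andP[_ /eqP def_v] /andP[_ /eqP def_u].
have k_gt1 : 1 < k by lia.
have : ((2 * d)%:R = 0%:R :> 'Z_k)%R.
  apply: (addrI (phi u)).
  by rewrite addr0 [in RHS]def_u def_v mul2n -addnn natrD addrA.
by move/(Zp_nat_eqmod k_gt1); rewrite mod0n modn_small //; lia.
Qed.

(** Raising the color of [u] alone lowers [phi v - phi u] by 1, which leaves the
    range from [d] to [k - d] only when the difference was [d]; then [uv] is
    tight and [v] is raised with [u]. *)
Lemma homomorphism_shift (T : finType) (k d : nat) (H : rel T)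
    (phi : T -> 'Z_k) (x : T) :
  1 < k -> 0 < d -> symmetric H ->
  homomorphism H (circular_clique k d) phi ->
  homomorphism H (circular_clique k d)
    (fun v => if connect (tight T k d H phi) x v then (phi v + 1)%R else phi v).
Proof.
move=> k_gt1 d_gt0 H_sym phi_hom.
(* An edge can only be affected when exactly one of its ends moves. *)
have boundary u v : H u v -> connect (tight T k d H phi) x u ->
    ~~ connect (tight T k d H phi) x v ->
    circular_clique k d (phi u + 1)%R (phi v).
  move=> Huv xu xv; apply: circular_clique_step => //; first exact: phi_hom.
  apply: contra xv => uv; apply: connect_trans xu (connect1 _).
  by rewrite /tight Huv.
move=> u v Huv.
have [xu | xu] := boolP (connect _ x u); have [xv | xv] := boolP (connect _ x v).
- case/(circular_cliqueP _ _ k_gt1 d_gt0): (phi_hom _ _ Huv) => z z_range ->.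
  by apply/circular_cliqueP => //; exists z; rewrite // addrAC.
- exact: boundary.
- by rewrite circular_clique_sym //; apply: boundary; rewrite // H_sym.
exact: phi_hom.
Qed.

Lemma connect_uniq_path (T : finType) (r : rel T) (x y : T) :
  connect r x y -> exists p, [/\ path r x p, uniq (x :: p) & last x p = y].
Proof.
by case/connectP=> p /shortenP[q xq q_uniq _] ->; exists q.
Qed.

(** A directed tight cycle returns to its starting color, so its length [l]
    satisfies [l * d = 0] modulo [k]. *)
Lemma tight_cycle (T : finType) (k d s : nat) (H : rel T) (phi : T -> 'Z_k)
    (u v : T) :
  2 < k -> s * d = 1 %[mod k] ->
  tight T k d H phi u v -> connect (tight T k d H phi) v u ->
  exists C : {set {set T}}, is_cycle H C /\ #|C| = 0 %[mod k].
Proof.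
move=> k_gt2 sd uv /connect_uniq_path[p [vp p_uniq def_u]].
have cyc : cycle (tight T k d H phi) (v :: p) by rewrite /= rcons_path vp def_u.
have size0 : size (v :: p) = 0 %[mod k].
  rewrite (@eqmod_mul_inverse k d s _ 0) //.
  apply: Zp_nat_eqmod; first exact: ltnW.
  apply: (addrI (phi v)); rewrite addr0.
  have := cyc; rewrite [cycle _ _]/= => /tight_path_color.
  by rewrite last_rcons size_rcons.
have size_gt2 : 2 < size (v :: p).
  apply: leq_trans k_gt2 (dvdn_leq _ _) => //.
  by rewrite /dvdn size0 mod0n.
exists (cyclic_edges (v :: p)); split; last by rewrite card_cyclic_edges.
exists (v :: p); split=> //; rewrite /ucycle p_uniq andbT.
exact: sub_cycle (@sub_tight _ _ _ _ _) _ cyc.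
Qed.

(** * Closing a tight path with the deleted edge *)

Lemma delete_edge_sym (T : finType) (G : rel T) (e : {set T}) :
  symmetric G -> symmetric (delete_edge G e).
Proof. by move=> G_sym u v; rewrite /delete_edge G_sym setUC. Qed.

Lemma delete_edge_path_cycle (T : finType) (G : rel T) (e : {set T}) (x y : T)
    (p : seq T) :
  simple_graph G -> e = [set x; y] -> G x y ->
  path (delete_edge G e) x p -> uniq (x :: p) -> last x p = y ->
  [/\ is_cycle G (cyclic_edges (x :: p)), e \in cyclic_edges (x :: p)
    & #|cyclic_edges (x :: p)| = (size p).+1].
Proof.
move=> [G_sym G_irr] def_e Gxy xp xp_uniq def_y.
have size_gt2 : 2 < size (x :: p).
  case: p xp def_y {xp_uniq} => [|v [|w p]] //=.
    by move=> _ xy; rewrite xy G_irr in Gxy.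
  by rewrite andbT => /andP[_] + def_v; rewrite def_v def_e eqxx.
split; last by rewrite card_cyclic_edges.
- exists (x :: p); split=> //; rewrite /ucycle xp_uniq andbT /= rcons_path def_y.
  by rewrite G_sym Gxy andbT; apply: sub_path xp => u v /andP[].
rewrite def_e setUC -{1}def_y -{2}(next_last xp_uniq).
exact/next_in_cyclic_edges/mem_last.
Qed.

Lemma homomorphism_restore_edge (T : finType) (k d : nat) (G : rel T)
    (e : {set T}) (phi : T -> 'Z_k) (x y : T) :
  1 < k -> 0 < d -> simple_graph G -> e = [set x; y] ->
  homomorphism (delete_edge G e) (circular_clique k d) phi ->
  circular_clique k d (phi x) (phi y) ->
  homomorphism G (circular_clique k d) phi.
Proof.
move=> k_gt1 d_gt0 [_ G_irr] def_e phi_hom clique_xy u v Guv.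
have [uv_e | uv_e] := eqVneq [set u; v] e; last first.
  by apply: phi_hom; rewrite /delete_edge Guv.
have: u \in [set x; y] by rewrite -def_e -uv_e set21.
have: v \in [set x; y] by rewrite -def_e -uv_e set22.
rewrite !in_set2 => /orP[] /eqP def_v /orP[] /eqP def_u.
- by rewrite def_u def_v G_irr in Guv.
- by rewrite def_u def_v circular_clique_sym.
- by rewrite def_u def_v.
- by rewrite def_u def_v G_irr in Guv.
Qed.

(** If the color of [x] is [m] steps ahead of that of [y], a tight path from [x]
    to [y] with [l] edges has [m + l * d = 0] modulo [k], so that
    [(l + 1) * d = d - m]. *)
Lemma tight_path_length (T : finType) (k d s m : nat) (H : rel T)
    (phi : T -> 'Z_k) (x y : T) (p : seq T) :
  1 < k -> m <= d -> s * d = 1 %[mod k] ->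
  path (tight T k d H phi) x p -> last x p = y ->
  phi x = (phi y + m%:R)%R -> (size p).+1 = (d - m) * s %[mod k].
Proof.
move=> k_gt1 le_md sd /tight_path_color + def_y; rewrite def_y => color_y color_x.
apply: eqmod_mul_inverse sd _; apply: Zp_nat_eqmod => //.
apply: (addIr m%:R%R); rewrite -[in RHS]natrD subnK // mulSn natrD -addrA.
rewrite -[RHS]addr0; congr (_ + _)%R; apply: (addrI (phi y)).
by rewrite addr0 [RHS]color_y color_x addrAC addrA.
Qed.

(** * The colors of the ends of the deleted edge *)

(** The induction is on the number [n] of shifts that separate the coloring
    from one in which [e] is properly colored. *)
Lemma no_coloring_ahead (T : finType) (G : rel T) (k d s n : nat) (e : {set T})
    (phi : T -> 'Z_k) (x y : T) :
  0 < d -> 2 * d < k -> s * d = 1 %[mod k] ->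
  simple_graph G -> e = [set x; y] -> G x y ->
  ~ circular_colorable k d G ->
  (forall (C : {set {set T}}) (i : nat),
     is_cycle G C -> e \in C -> 1 <= i <= d - 1 -> #|C| <> i * s %[mod k]) ->
  homomorphism (delete_edge G e) (circular_clique k d) phi ->
  n < d -> phi x = (phi y + (d - n)%:R)%R -> False.
Proof.
move=> d_gt0 d2k sd G_simple def_e Gxy G_ncol no_cycle.
have k_gt1 : 1 < k by lia.
have [G_sym _] := G_simple.
elim: n phi => [|n IHn] phi phi_hom lt_nd color_x.
  apply: G_ncol; exists phi.
  apply: (homomorphism_restore_edge k_gt1 d_gt0 G_simple def_e phi_hom).
  rewrite circular_clique_sym //; apply/circular_cliqueP => //.
  by exists d; [lia | rewrite color_x subn0].
have [xy | not_xy] := boolP (connect (tight T k d (delete_edge G e) phi) x y).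
  have [p [xp p_uniq def_y]] := connect_uniq_path xy.
  have [C_cycle eC card_C] := delete_edge_path_cycle G_simple def_e
    Gxy (sub_path (@sub_tight _ _ _ _ _) xp) p_uniq def_y.
  have n_range : 1 <= n.+1 <= d - 1 by lia.
  apply: no_cycle C_cycle eC n_range _.
  have le_dn : d - n.+1 <= d by lia.
  rewrite card_C (tight_path_length k_gt1 le_dn sd xp def_y color_x).
  by rewrite subKn // ltnW.
apply: (IHn _ (homomorphism_shift x k_gt1 d_gt0 _ phi_hom)).
- exact: delete_edge_sym.
- exact: ltnW.
rewrite connect0 (negPf not_xy) color_x -addrA natr1.
by congr (_ + _%:R)%R; lia.
Qed.

(** A coloring of [G - e] that separates [x] from [y] puts the color of one of
    them at most [d] steps ahead of the other, or is a coloring of [G]; both are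
    impossible. *)
Lemma same_end_color (T : finType) (G : rel T) (k d s : nat) (e : {set T})
    (phi : T -> 'Z_k) (x y : T) :
  0 < d -> 2 * d < k -> s * d = 1 %[mod k] ->
  simple_graph G -> e = [set x; y] -> G x y ->
  ~ circular_colorable k d G ->
  (forall (C : {set {set T}}) (i : nat),
     is_cycle G C -> e \in C -> 1 <= i <= d - 1 -> #|C| <> i * s %[mod k]) ->
  homomorphism (delete_edge G e) (circular_clique k d) phi ->
  phi x = phi y.
Proof.
move=> d_gt0 d2k sd G_simple def_e Gxy G_ncol no_cycle phi_hom.
have k_gt1 : 1 < k by lia.
have def_e' : e = [set y; x] by rewrite def_e setUC.
have Gyx : G y x by case: G_simple => -> _.
have := natr_Zp (phi x - phi y)%R.
have : (phi x - phi y)%R < k by apply: leq_trans (ltn_ord _) _; rewrite Zp_cast.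
move: (nat_of_ord _) => c lt_ck def_c.
have color_x : phi x = (phi y + c%:R)%R by rewrite def_c addrC subrK.
have color_y : phi y = (phi x + (k - c)%:R)%R.
  by rewrite color_x natrB ?(ltnW lt_ck) // pchar_Zp // add0r addrK.
have [c0 | c_gt0] := posnP c; first by rewrite color_x c0 addr0.
have [le_cd | lt_dc] := leqP c d.
  have lt_nd : d - c < d by lia.
  case: (no_coloring_ahead d_gt0 d2k sd G_simple def_e Gxy G_ncol no_cycle
    phi_hom lt_nd); by rewrite subKn.
have [le_cd | lt_dc'] := leqP (k - c) d.
  have lt_nd : d - (k - c) < d by lia.
  case: (no_coloring_ahead d_gt0 d2k sd G_simple def_e' Gyx G_ncol no_cycle
    phi_hom lt_nd); by rewrite subKn.
case: G_ncol; exists phi.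
apply: (homomorphism_restore_edge k_gt1 d_gt0 G_simple def_e' phi_hom).
by apply/circular_cliqueP => //; exists c; first lia.
Qed.

(** Otherwise a shift would separate the equal colors of [x] and [y]. *)
Lemma tight_connected_ends (T : finType) (G : rel T) (k d s : nat)
    (e : {set T}) (phi : T -> 'Z_k) (x y : T) :
  0 < d -> 2 * d < k -> s * d = 1 %[mod k] ->
  simple_graph G -> e = [set x; y] -> G x y ->
  ~ circular_colorable k d G ->
  (forall (C : {set {set T}}) (i : nat),
     is_cycle G C -> e \in C -> 1 <= i <= d - 1 -> #|C| <> i * s %[mod k]) ->
  homomorphism (delete_edge G e) (circular_clique k d) phi ->
  connect (tight T k d (delete_edge G e) phi) x y.
Proof.
move=> d_gt0 d2k sd G_simple def_e Gxy G_ncol no_cycle phi_hom.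
have k_gt1 : 1 < k by lia.
have H_sym := delete_edge_sym e (proj1 G_simple).
apply/idPn => not_xy.
have := same_end_color d_gt0 d2k sd G_simple def_e Gxy G_ncol no_cycle
  (homomorphism_shift x k_gt1 d_gt0 H_sym phi_hom).
rewrite connect0 (negPf not_xy).
rewrite (same_end_color d_gt0 d2k sd G_simple def_e Gxy G_ncol no_cycle phi_hom).
by rewrite -[RHS]addr0 => /addrI/eqP; rewrite oner_eq0.
Qed.

Theorem proposition6 (k d : nat) (s : 'Z_k)
    (T : finType) (G : rel T) (e : {set T}) :
  0 < k -> 0 < d -> coprime k d -> 2 * d < k ->
  s * d = 1 %[mod k] ->
  simple_graph G ->
  e \in edges G ->
  circular_colorable k d (delete_edge G e) ->
  ~ circular_colorable k d G ->
  (forall (C : {set {set T}}) (i : nat),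
     is_cycle G C -> e \in C -> 1 <= i <= d - 1 ->
     #|C| <> i * s %[mod k]) ->
  (exists C1 C2 : {set {set T}},
     [/\ C1 <> C2,
         [/\ is_cycle G C1, e \in C1 & #|C1| = 1 %[mod k]]
       & [/\ is_cycle G C2, e \in C2 & #|C2| = 1 %[mod k]]])
  /\ (exists C : {set {set T}},
        is_cycle (delete_edge G e) C /\ #|C| = 0 %[mod k]).
Proof.
move=> _ d_gt0 _ d2k sd G_simple /imset2P[x y _] + def_e [phi phi_hom] G_ncol.
rewrite inE => /andP[_ Gxy] no_cycle.
have k_gt1 : 1 < k by lia.
have def_e' : e = [set y; x] by rewrite def_e setUC.
have Gyx : G y x by case: G_simple => -> _.
have color_xy := same_end_color d_gt0 d2k sd G_simple def_e Gxy G_ncol no_cycle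
  phi_hom.
have xy := tight_connected_ends d_gt0 d2k sd G_simple def_e Gxy G_ncol no_cycle
  phi_hom.
have yx := tight_connected_ends d_gt0 d2k sd G_simple def_e' Gyx G_ncol no_cycle
  phi_hom.
have closed_length u v p : path (tight T k d (delete_edge G e) phi) u p ->
    last u p = v -> phi u = phi v -> (size p).+1 = 1 %[mod k].
  move=> up def_v eq_uv; rewrite -sd mulnC -[d]subn0.
  by apply: (tight_path_length k_gt1 _ sd up def_v); rewrite ?addr0.
have [p [xp p_uniq p_last]] := connect_uniq_path xy.
have [q [yq q_uniq q_last]] := connect_uniq_path yx.
have [C1_cycle eC1 card_C1] := delete_edge_path_cycle G_simple def_e Gxy
  (sub_path (@sub_tight _ _ _ _ _) xp) p_uniq p_last.
have [C2_cycle eC2 card_C2] := delete_edge_path_cycle G_simple def_e' Gyx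
  (sub_path (@sub_tight _ _ _ _ _) yq) q_uniq q_last.
have neq_xy : x != y by apply: contraTneq Gxy => ->; rewrite (proj2 G_simple).
case: p xp p_uniq p_last C1_cycle eC1 card_C1 => [|v p] xp p_uniq p_last.
  by rewrite -p_last eqxx in neq_xy.
move=> C1_cycle eC1 card_C1.
have /= /andP[xv vp] := xp.
split; last first.
  apply: (tight_cycle _ sd xv); first by lia.
  by apply: connect_trans yx; apply/connectP; exists p.
exists (cyclic_edges [:: x, v & p]), (cyclic_edges (y :: q)); split; first last.
- by split; rewrite // card_C2; apply: closed_length yq q_last _.
- by split; rewrite // card_C1; apply: closed_length xp p_last _.
(* The first edge [xv] of the path from [x] would be an edge of the second cycle
   at [x]; the two edges there are [e] and an arc tight towards [x]. *)
move=> eq_C; have xv_C2 : [set x; v] \in cyclic_edges (y :: q).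
  rewrite -eq_C; have /= := next_in_cyclic_edges (mem_head x (v :: p)).
  by rewrite eqxx.
case: (cyclic_edges_at q_uniq xv_C2) => def_v.
  move: (next_last q_uniq); rewrite q_last -def_v => v_y.
  by case/andP: xv => /andP[_]; rewrite v_y def_e eqxx.
(* Adding the arc [xy] closes the second path to a directed cycle, in which the
   predecessor of [x] is the start of a tight arc. *)
pose arc a b := tight T k d (delete_edge G e) phi a b || (a == x) && (b == y).
have cyc : cycle arc (y :: q).
  rewrite /= rcons_path q_last /arc !eqxx orbT andbT.
  by apply: sub_path yq => a b ->.
have x_yq : x \in y :: q by rewrite -q_last mem_last.
have := prev_cycle cyc x_yq; rewrite -def_v /arc (negPf neq_xy) andbF orbF.
exact: tight_asym xv.
Qed.
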